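(* Consider an interval linear program given by an interval matrix $\mathbf{A}$ and interval vectors $\mathbf{b},\mathbf{c}$. Its duality gap is strongly zero if the primal interval linear program or its dual interval linear program is strongly feasible.
   Context: For real matrices $\underline{A}\le\overline{A}$ in $\mathbb{R}^{m\times n}$ (entrywise order), the interval matrix $\mathbf{A}=[\underline{A},\overline{A}]$ is the set $\{A\in\mathbb{R}^{m\times n}:\underline{A}\le A\le\overline{A}\}$; interval vectors $\mathbf{b}=[\underline b,\overline b]\subseteq\mathbb{R}^m$ and $\mathbf{c}=[\underline c,\overline c]\subseteq\mathbb{R}^n$ are defined analogously. An interval linear program (ILP) is the family of linear programs $\min\{c^{\top}x : x\in\mathcal{M}(A,b)\}$ with $A\in\mathbf{A}$, $b\in\mathbf{b}$, $c\in\mathbf{c}$, where $\mathcal{M}(A,b)\subseteq\mathbb{R}^n$ is described by linear equations and inequalities of a fixed form: each row is of the form $(Ax)_i=b_i$, $(Ax)_i\le b_i$ or $(Ax)_i\ge b_i$, and each variable is free, nonnegative or nonpositive, the same pattern being used for all $(A,b,c)$. A choice $(A,b,c)$ with $A\in\mathbf{A},b\in\mathbf{b},c\in\mathbf{c}$ is called a scenario. The dual ILP is the family of the usual linear programming duals of the scenarios: $\max b^{\top}y$ with $y_i$ free, $\le 0$, $\ge 0$ according to whether row $i$ is an equation, a $\le$ or a $\ge$ inequality, and with $(A^{\top}y)_j= c_j$, $\le c_j$, $\ge c_j$ according to whether $x_j$ is free, nonnegative, nonpositive. An ILP (primal or dual) is strongly feasible if it is feasible for all scenarios. The duality gap of a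 linear program is the difference between the primal and dual optimal values; it is zero if and only if at least one of the primal or the dual program is feasible, and it is $\infty$ otherwise. The duality gap of the ILP is strongly zero if all scenarios have zero duality gap. *)

(* Defs.v *)
From mathcomp Require Import all_boot all_order all_algebra.
From mathcomp Require Import boolp classical_sets reals constructive_ereal ereal.

Set Implicit Arguments.
Unset Strict Implicit.
Unset Printing Implicit Defensive.

Import Order.TTheory GRing.Theory Num.Theory.

Local Open Scope classical_set_scope.
Local Open Scope ring_scope.

Definition mx_le (R : realType) (m n : nat) (A B : 'M[R]_(m, n)) : Prop :=
  forall i j, A i j <= B i j.

(* Interval vectors are interval matrices with one column. *)
Record interval_mx (R : realType) (m n : nat) := IntervalMx {
  lower_mx : 'M[R]_(m, n);
  upper_mx : 'M[R]_(m, n);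
  lower_le_upper_mx : mx_le lower_mx upper_mx
}.

Definition mx_of_interval (R : realType) (m n : nat) (I : interval_mx R m n) :
    set 'M[R]_(m, n) :=
  [set A | mx_le (lower_mx I) A /\ mx_le A (upper_mx I)].

Inductive row_sense := RowEq | RowLe | RowGe.
Inductive var_sense := VarFree | VarNonneg | VarNonpos.

Definition row_holds (R : realType) (s : row_sense) (u v : R) : Prop :=
  match s with
  | RowEq => u = v
  | RowLe => u <= v
  | RowGe => u >= v
  end.

Definition var_holds (R : realType) (s : var_sense) (u : R) : Prop :=
  match s with
  | VarFree => True
  | VarNonneg => 0 <= u
  | VarNonpos => u <= 0
  end.

Definition feasible_set (R : realType) (m n : nat)
    (rs : 'I_m -> row_sense) (vs : 'I_n -> var_sense)
    (A : 'M[R]_(m, n)) (b : 'cV[R]_m) : set 'cV[R]_n :=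
  [set x | (forall i, row_holds (rs i) ((A *m x) i 0) (b i 0)) /\
           (forall j, var_holds (vs j) (x j 0))].

Definition dual_var_sense (s : row_sense) : var_sense :=
  match s with
  | RowEq => VarFree
  | RowLe => VarNonpos
  | RowGe => VarNonneg
  end.

Definition dual_row_sense (s : var_sense) : row_sense :=
  match s with
  | VarFree => RowEq
  | VarNonneg => RowLe
  | VarNonpos => RowGe
  end.

Definition dual_feasible_set (R : realType) (m n : nat)
    (rs : 'I_m -> row_sense) (vs : 'I_n -> var_sense)
    (A : 'M[R]_(m, n)) (c : 'cV[R]_n) : set 'cV[R]_m :=
  feasible_set (fun j => dual_row_sense (vs j)) (fun i => dual_var_sense (rs i))
    A^T c.

(* +oo when the program is infeasible, -oo when it is unbounded. *)
Definition primal_value (R : realType) (m n : nat)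
    (rs : 'I_m -> row_sense) (vs : 'I_n -> var_sense)
    (A : 'M[R]_(m, n)) (b : 'cV[R]_m) (c : 'cV[R]_n) : \bar R :=
  ereal_inf [set ((c^T *m x) 0 0)%:E | x in feasible_set rs vs A b].

(* -oo when the dual is infeasible, +oo when it is unbounded. *)
Definition dual_value (R : realType) (m n : nat)
    (rs : 'I_m -> row_sense) (vs : 'I_n -> var_sense)
    (A : 'M[R]_(m, n)) (b : 'cV[R]_m) (c : 'cV[R]_n) : \bar R :=
  ereal_sup [set ((b^T *m y) 0 0)%:E | y in dual_feasible_set rs vs A c].

(* Two equal infinite values (one program unbounded, the other infeasible)
   have difference 0, whereas in \bar R, +oo - +oo and -oo - -oo are -oo.
   If both programs are infeasible, the gap is +oo - -oo = +oo. *)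
Definition duality_gap (R : realType) (m n : nat)
    (rs : 'I_m -> row_sense) (vs : 'I_n -> var_sense)
    (A : 'M[R]_(m, n)) (b : 'cV[R]_m) (c : 'cV[R]_n) : \bar R :=
  let p := primal_value rs vs A b c in
  let d := dual_value rs vs A b c in
  if p == d then 0%E else (p - d)%E.

Definition scenario (R : realType) (m n : nat) (IA : interval_mx R m n)
    (Ib : interval_mx R m 1) (Ic : interval_mx R n 1)
    (A : 'M[R]_(m, n)) (b : 'cV[R]_m) (c : 'cV[R]_n) : Prop :=
  [/\ mx_of_interval IA A, mx_of_interval Ib b & mx_of_interval Ic c].

Definition primal_strongly_feasible (R : realType) (m n : nat)
    (rs : 'I_m -> row_sense) (vs : 'I_n -> var_sense)
    (IA : interval_mx R m n) (Ib : interval_mx R m 1)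
    (Ic : interval_mx R n 1) : Prop :=
  forall A b c, scenario IA Ib Ic A b c -> feasible_set rs vs A b !=set0.

Definition dual_strongly_feasible (R : realType) (m n : nat)
    (rs : 'I_m -> row_sense) (vs : 'I_n -> var_sense)
    (IA : interval_mx R m n) (Ib : interval_mx R m 1)
    (Ic : interval_mx R n 1) : Prop :=
  forall A b c, scenario IA Ib Ic A b c -> dual_feasible_set rs vs A c !=set0.

Definition gap_strongly_zero (R : realType) (m n : nat)
    (rs : 'I_m -> row_sense) (vs : 'I_n -> var_sense)
    (IA : interval_mx R m n) (Ib : interval_mx R m 1)
    (Ic : interval_mx R n 1) : Prop :=
  forall A b c, scenario IA Ib Ic A b c -> duality_gap rs vs A b c = 0%E.

(* Main.v *)
Require Import Defs.
From mathcomp Require Import all_boot all_order all_algebra.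
From mathcomp Require Import boolp classical_sets reals constructive_ereal ereal.
From mathcomp Require Import ring lra.

(** The interval data only quantify over scenarios, so the claim is strong
    duality scenario by scenario: if a linear program or its dual is feasible,
    both have the same value in the extended reals.

    Weak duality, [weak_duality], gives one inequality. For the other one, a
    strict inequality dual value < primal value would leave room for a real
    number t strictly in between. If the primal is feasible, t is a strict lower
    bound of its objective, and [primal_bound_certified] yields a dual feasible y
    with objective at least t, a contradiction. If instead the dual is feasible,
    [dual_bound_certified] yields a primal feasible x with objective at most t;
    it is the same lemma read on the dual program, whose dual is the primal up to
    the change of variable x |-> - x. Arguing with a separating t treats bounded
    and unbounded programs at once, and attainment of the optima is never
    discussed.

    The certificate comes from Farkas' lemma, [farkas], for linear functionals on
    an arbitrary real vector space. The bound t is homogenized: on pairs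
    (x, tau), writing ~ for the sense of each row, the constraints A x ~ tau b,
    c x <= t tau and the sign conditions force tau <= 0, since otherwise x / tau
    would be feasible with objective at most t. Hence tau is dominated by a combination of the constraints whose
    coefficients y and l (the coefficient of the objective row) satisfy
    A^T y ~ l c and b y >= l t + 1. Weak duality against a feasible point
    excludes l = 0, and y / l is the wanted dual point. *)

Set Implicit Arguments.
Unset Strict Implicit.
Unset Printing Implicit Defensive.

Import Order.TTheory GRing.Theory Num.Theory.

Local Open Scope classical_set_scope.
Local Open Scope ring_scope.

(** * Farkas' lemma *)

Lemma scalar_le0_eq0 (R : realFieldType) (V : lmodType R) (f : V -> R) :
  scalar f -> (forall v, f v <= 0) -> f = fun=> 0.
Proof.
move=> lin_f f_le0; apply/funext => v.
have f0 : f 0 = 0 by have := lin_f 1 0 0; rewrite scaler0 addr0; lra.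
have := lin_f (-1) v 0; rewrite addr0 f0 => fN.
have := f_le0 (-1 *: v); have := f_le0 v; lra.
Qed.

(** Bartl's algebraic proof, by induction on the number of constraints. The
    conclusion is phrased with an arbitrary convex cone P of functionals that
    contains the F i, in place of explicit nonnegative coefficients: the
    induction then has no coefficients to carry along, and the user chooses for P
    the form in which the certificate is wanted. *)
Lemma farkas (R : realFieldType) (V : lmodType R) (P : (V -> R) -> Prop)
    (P0 : P (fun=> 0))
    (PD : forall k f g, 0 <= k -> P f -> P g -> P (fun v => f v + k * g v))
    (I : eqType) (s : seq I) (F : I -> V -> R) (f : V -> R) :
  {in s, forall i, scalar (F i)} -> scalar f ->
  {in s, forall i, P (F i)} ->
  (forall v, {in s, forall i, F i v <= 0} -> f v <= 0) ->
  P f.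
Proof.
elim: s F f => [|i0 s IHs] F f linF linf PF Ff.
  by rewrite (scalar_le0_eq0 linf) // => v; apply: Ff.
have sub_s i : i \in s -> i \in i0 :: s by rewrite inE orbC => ->.
have i0s : i0 \in i0 :: s by rewrite mem_head.
have [Ff_s|] := pselect (forall v, {in s, forall i, F i v <= 0} -> f v <= 0).
  by apply: (IHs F) => // i /sub_s; [apply: linF|apply: PF].
(* The point w shows that the constraint a = F i0 is needed. All functionals are
   replaced by their compositions with the projection along w onto the kernel of
   a; for those, the constraint a is void and the induction hypothesis
   applies. The signs at w make F i o projection and f, in turn, combinations of
   a and of F i, resp. f o projection, with nonnegative coefficients. *)
move=> /existsNP[w /not_implyP[Fw /negP]]; rewrite -ltNge => fw.
set a := F i0; have lina : scalar a by apply: linF.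
have aw : 0 < a w.
  rewrite ltNge; apply/negP => aw; move: fw; rewrite ltNge => /negP; apply.
  by apply: Ff => i; rewrite inE => /orP[/eqP->|/Fw].
have aw0 : a w != 0 by rewrite gt_eqF.
pose pr (g : V -> R) v := g v + (- (g w / a w)) * a v.
have lin_pr g : scalar g -> scalar (pr g).
  by move=> ling k u v; rewrite /pr ling lina; ring.
have prE g v : scalar g -> pr g v = g ((- (a v / a w)) *: w + v).
  by move=> ling; rewrite ling /pr; field.
have -> : f = fun v => pr f v + f w / a w * a v.
  by apply/funext => v; rewrite /pr mulNr subrK.
apply: (PD); [by rewrite divr_ge0 ?ltW| |exact: PF].
apply: (IHs (fun i => pr (F i))).
- by move=> i /sub_s /linF /lin_pr.
- exact: lin_pr.
- move=> i si; apply: (PD); [|exact/PF/sub_s|exact: PF].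
  by rewrite -mulNr divr_ge0 ?oppr_ge0 ?Fw ?ltW.
move=> v Fv; rewrite prE //; apply: Ff => i; rewrite inE => /orP[/eqP->|si].
  by rewrite -/a lina; have -> : - (a v / a w) * a w + a v = 0 by field.
by rewrite -prE; [apply: Fv|apply/linF/sub_s].
Qed.

(** * Senses of rows and signs of multipliers *)

(** The sign condition on a dual variable is polar to the sense of its row. This
    single description of the senses carries both weak duality and the reading
    of a certificate as a dual feasible point. *)
Lemma row_holds_polar (R : realType) s (u v : R) :
  row_holds s u v <->
  forall k, var_holds (dual_var_sense s) k -> 0 <= k * (u - v).
Proof.
split; case: s => /=.
- by move=> -> k _; rewrite subrr mulr0.
- by move=> uv k k0; rewrite mulr_le0 // subr_le0.
- by move=> uv k k0; rewrite mulr_ge0 // subr_ge0.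
- by move=> H; have := H 1 Logic.I; have := H (-1) Logic.I; lra.
- by move=> H; have := H (-1) (lerN10 _); lra.
- by move=> H; have := H 1 ler01; lra.
Qed.

(** Each row is split into two inequalities indexed by a boolean, which are equal
    unless the row is an equation. By polarity, a row reads 0 <= k * g i v for
    every k with the sign of its dual variable, which is why the cone P is asked
    to contain the functionals - k * g i. *)
Lemma farkas_sense (R : realType) (V : lmodType R) (P : (V -> R) -> Prop)
    (P0 : P (fun=> 0))
    (PD : forall k f g, 0 <= k -> P f -> P g -> P (fun v => f v + k * g v))
    (I : finType) (s : I -> row_sense) (g : I -> V -> R) (f : V -> R) :
  (forall i, scalar (g i)) -> scalar f ->
  (forall i k, var_holds (dual_var_sense (s i)) k -> P (fun v => - k * g i v)) ->
  (forall v, (forall i, row_holds (s i) (g i v) 0) -> f v <= 0) ->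
  P f.
Proof.
move=> ling linf Pg gf.
pose k (ib : I * bool) : R :=
  match s ib.1 with RowEq => (-1) ^+ ib.2 | RowLe => -1 | RowGe => 1 end.
have Kk ib : var_holds (dual_var_sense (s ib.1)) (k ib).
  by rewrite /k; case: (s ib.1) => //=; lra.
apply: (farkas P0 PD (s := enum {: I * bool})
  (F := fun ib v => - k ib * g ib.1 v)) => //.
- by move=> ib _ a u v; rewrite ling; ring.
- by move=> ib _; apply: Pg.
move=> v Fv; apply: gf => i.
have := Fv (i, true) (mem_enum _ _); have := Fv (i, false) (mem_enum _ _).
by rewrite /k /=; case: (s i) => /=; lra.
Qed.

Lemma var_holdsD (R : realType) r (u v k : R) : 0 <= k ->
  var_holds r u -> var_holds r v -> var_holds r (u + k * v).
Proof. by case: r => //= k0 u0 v0; nra. Qed.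

Lemma var_holds0 (R : realType) r : var_holds r (0 : R).
Proof. by case: r => //=. Qed.

Lemma dual_var_row_sense (R : realType) r (u : R) :
  var_holds (dual_var_sense (dual_row_sense r)) u <-> var_holds r (- u).
Proof. by case: r => //=; split; lra. Qed.

Lemma dual_row_var_sense (R : realType) s (u v : R) :
  row_holds (dual_row_sense (dual_var_sense s)) u v <-> row_holds s (- u) (- v).
Proof. by case: s => /=; split; lra. Qed.

(** * Duality of linear programs *)

Lemma feasible_setZ (R : realType) (m n : nat) (rs : 'I_m -> row_sense)
    (vs : 'I_n -> var_sense) (A : 'M[R]_(m, n)) (b : 'cV[R]_m) (x : 'cV[R]_n)
    (k : R) :
  0 <= k ->
  feasible_set rs vs A b x -> feasible_set rs vs A (k *: b) (k *: x).
Proof.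
move=> k0 [Ax_b xK]; split=> [i|j].
  have := Ax_b i; rewrite -scalemxAr !mxE; case: (rs i) => /= [->//| |];
    exact: ler_wpM2l.
by have := var_holdsD k0 (var_holds0 R (vs j)) (xK j); rewrite !mxE add0r.
Qed.

Section LinearProgram.
Variables (R : realType) (m n : nat).
Variables (rs : 'I_m -> row_sense) (vs : 'I_n -> var_sense).
Variable (A : 'M[R]_(m, n)).
Implicit Types (b y : 'cV[R]_m) (c x : 'cV[R]_n).

(** Complementarity: c x - b y is the sum of the products x_j (c - A^T y)_j and
    y_i (A x - b)_i, each nonnegative by polarity. *)
Lemma weak_duality b c x y :
  feasible_set rs vs A b x -> dual_feasible_set rs vs A c y ->
  (b^T *m y) 0 0 <= (c^T *m x) 0 0.
Proof.
move=> [Ax_b xK] [Ay_c yK].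
have by_Ax : (b^T *m y) 0 0 <= ((A *m x)^T *m y) 0 0.
  rewrite -subr_ge0 2!mxE -sumrB; apply: sumr_ge0 => i _.
  rewrite -mulrBl mulrC [_^T _ _]mxE [b^T _ _]mxE.
  by have /row_holds_polar := Ax_b i; apply; apply: yK.
apply: le_trans by_Ax _; have -> : ((A *m x)^T *m y) = ((A^T *m y)^T *m x)^T.
  by rewrite !trmx_mul !trmxK mulmxA.
rewrite [leLHS]mxE -subr_ge0 2!mxE -sumrB; apply: sumr_ge0 => j _.
rewrite -mulrBl mulrC -mulrNN opprB [_^T _ _]mxE [c^T _ _]mxE.
have /row_holds_polar := Ay_c j; apply; apply/dual_var_row_sense.
by rewrite opprK.
Qed.

(** Farkas' lemma for the homogenized system. The strictness of the bound t makes
    the system A x ~ b, c x <= t infeasible, hence tau <= 0 is implied by the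
    homogenized one without any analysis of recession directions. *)
Lemma primal_bound_certified b c t :
  feasible_set rs vs A b !=set0 ->
  (forall x, feasible_set rs vs A b x -> t < (c^T *m x) 0 0) ->
  exists2 y, dual_feasible_set rs vs A c y & t <= (b^T *m y) 0 0.
Proof.
move=> [x0 feas_x0] t_lt.
pose V : lmodType R := ('cV[R]_n * R^o)%type.
pose h (y : 'cV[R]_m) (l : R) (v : V) : R :=
  l * ((c^T *m v.1) 0 0 - t * v.2) - (y^T *m (A *m v.1 - v.2 *: b)) 0 0.
have h0 l v : h 0 l v = l * ((c^T *m v.1) 0 0 - t * v.2).
  by rewrite /h trmx0 mul0mx [X in _ - X]mxE subr0.
(* The cone of functionals dominated, on the sign-constrained x and for every tau,
   by a combination of the objective row with coefficient l >= 0 and of the rows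
   of A with coefficients - y. The sign conditions on x are absorbed in this
   domination, so they get no multipliers of their own. *)
pose P (f : V -> R) := exists (y : 'cV[R]_m) (l : R),
  [/\ forall i, var_holds (dual_var_sense (rs i)) (y i 0), 0 <= l &
      forall v : V, (forall j, var_holds (vs j) (v.1 j 0)) -> f v <= h y l v].
(* The constraints: None is the objective row, inl the rows of A, inr the sign
   conditions; the null functional encodes a free variable. *)
pose g (i : option ('I_m + 'I_n)) (v : V) : R :=
  match i with
  | None => (c^T *m v.1) 0 0 - t * v.2
  | Some (inl i) => (A *m v.1 - v.2 *: b) i 0
  | Some (inr j) =>
      match vs j with
      | VarFree => 0
      | VarNonneg => v.1 j 0
      | VarNonpos => - v.1 j 0
      end
  end.
pose s (i : option ('I_m + 'I_n)) :=
  match i with None => RowLe | Some (inl i) => rs i | Some (inr _) => RowGe end.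
have : P (fun v => v.2).
  apply: (@farkas_sense R V P _ _ _ s g).
  - exists 0, 0; split=> [i||v _] //; first by rewrite mxE; apply: var_holds0.
    by rewrite h0 mul0r.
  - move=> k f1 f2 k0 [y1 [l1 [y1K l10 f1h]]] [y2 [l2 [y2K l20 f2h]]].
    exists (y1 + k *: y2), (l1 + k * l2); split=> [i||v vK].
    + by rewrite !mxE; apply: var_holdsD.
    + by rewrite addr_ge0 // mulr_ge0.
    have -> : h (y1 + k *: y2) (l1 + k * l2) v = h y1 l1 v + k * h y2 l2 v.
      have trD : (y1 + k *: y2)^T = y1^T + k *: y2^T.
        by apply/matrixP => i j; rewrite !mxE.
      rewrite /h trD mulmxDl -scalemxAl.
      by set z := A *m _ - _; rewrite !mxE; ring.
    by apply: lerD; [exact: f1h|apply: ler_wpM2l => //; exact: f2h].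
  - case=> [[i|j]|] a u v /=.
    + rewrite -[a *: u.2 + v.2]/(a * u.2 + v.2) mulmxDr -scalemxAr scalerDl.
      rewrite -scalerA opprD addrACA -scalerBr.
      by set p := A *m u.1 - _; set q := A *m v.1 - _; rewrite !mxE.
    + by case: (vs j); rewrite ?mxE; ring.
    + rewrite -[a *: u.2 + v.2]/(a * u.2 + v.2) mulmxDr -scalemxAr.
      by set p := c^T *m u.1; set q := c^T *m v.1; rewrite !mxE; ring.
  - by move=> a u v.
  - case=> [[i|j]|] k /= kK.
    + exists (k *: delta_mx i 0), 0; split=> // [i'|v _].
        rewrite !mxE andbT; case: eqP => [->|_]; rewrite ?mulr1 ?mulr0 //.
        exact: var_holds0.
      rewrite /h mul0r sub0r [(_ *: _)^T]linearZ /= -scalemxAl trmx_delta -rowE.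
      by set p := A *m v.1 - _; rewrite !mxE mulNr.
    + exists 0, 0; split=> // [i|v vK]; first by rewrite mxE; apply: var_holds0.
      rewrite h0 mul0r.
      by have := vK j; case: (vs j) => /=; nra.
    + exists 0, (- k); split=> [i||v _]; first by rewrite mxE; apply: var_holds0.
        by rewrite oppr_ge0.
      by rewrite h0.
  move=> v gv; rewrite leNgt; apply/negP => v2.
  have feas_v : feasible_set rs vs A b (v.2^-1 *: v.1).
    have -> : b = v.2^-1 *: (v.2 *: b) by rewrite scalerA mulVf ?scale1r ?gt_eqF.
    apply: feasible_setZ; first by rewrite invr_ge0 ltW.
    split=> [i|j].
      have := gv (Some (inl i)); rewrite /=; set p := A *m v.1; rewrite !mxE.
      by case: (rs i) => /=; lra.
    by have := gv (Some (inr j)) => /=; case: (vs j) => //=; lra.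
  have := t_lt _ feas_v; rewrite -scalemxAr mxE mulrC ltr_pdivlMr //.
  by have := gv None => /=; lra.
move=> [y [l [yK l0 hy]]].
have hyE tau x : (forall j, var_holds (vs j) (x j 0)) ->
    tau <= l * ((c^T *m x) 0 0 - t * tau) - (y^T *m (A *m x - tau *: b)) 0 0.
  exact: hy (x, tau).
(* Evaluate the certificate at x = 0, tau = 1. *)
have yl_ge1 : l * t + 1 <= (b^T *m y) 0 0.
  have -> : b^T *m y = (y^T *m b)^T by rewrite trmx_mul trmxK.
  have /(hyE 1) : forall j, var_holds (vs j) ((0 : 'cV[R]_n) j 0).
    by move=> j; rewrite mxE; apply: var_holds0.
  rewrite !mulmx0 scale1r sub0r mulmxN; set p := y^T *m b; rewrite !mxE; lra.
(* Evaluate the certificate at tau = 0 and at the multiples of the j-th basis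
   vector that satisfy the sign condition on x_j. *)
have feas_y : dual_feasible_set rs vs A (l *: c) y.
  split=> // j; apply/row_holds_polar => k /dual_var_row_sense kK.
  have /(hyE 0) : forall j',
      var_holds (vs j') ((- k *: delta_mx j 0 : 'cV[R]_n) j' 0).
    move=> j'; rewrite !mxE andbT; case: eqP => [->|_]; rewrite ?mulr1 ?mulr0 //.
    exact: var_holds0.
  have -> : A^T *m y = (y^T *m A)^T by rewrite trmx_mul trmxK.
  rewrite scale0r subr0 -!scalemxAr mulmxA -!colE.
  by set p := y^T *m A; rewrite !mxE; lra.
(* If l = 0, then y is dual feasible for the objective c = 0, so b y <= 0 by weak
   duality against x0, while b y >= 1. *)
have l_gt0 : 0 < l.
  rewrite lt_neqAle l0 andbT; apply/eqP => l_0.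
  have := weak_duality feas_x0 feas_y.
  rewrite -l_0 scale0r trmx0 mul0mx [leRHS]mxE.
  by move: yl_ge1; rewrite -l_0 mul0r; lra.
exists (l^-1 *: y).
  have -> : c = l^-1 *: (l *: c) by rewrite scalerA mulVf ?scale1r ?gt_eqF.
  by apply: feasible_setZ; rewrite // invr_ge0.
by rewrite -scalemxAr mxE mulrC ler_pdivlMr // mulrC; lra.
Qed.

End LinearProgram.

Lemma dual_dual_feasible (R : realType) (m n : nat) (rs : 'I_m -> row_sense)
    (vs : 'I_n -> var_sense) (A : 'M[R]_(m, n)) (b : 'cV[R]_m) (x : 'cV[R]_n) :
  dual_feasible_set (fun j => dual_row_sense (vs j))
    (fun i => dual_var_sense (rs i)) A^T (- b) x ->
  feasible_set rs vs A b (- x).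
Proof.
rewrite /dual_feasible_set trmxK => -[Ax_b xK]; split=> [i|j].
  have := Ax_b i; rewrite mulmxN [X in row_holds _ _ X]mxE => /dual_row_var_sense.
  by rewrite opprK => Ax_bi; rewrite [X in row_holds _ X _]mxE.
by have /dual_var_row_sense := xK j; rewrite mxE.
Qed.

(** The dual program is the minimization of - b y over the dual feasible set;
    [primal_bound_certified] applies to it with the bound - t. *)
Lemma dual_bound_certified (R : realType) (m n : nat) (rs : 'I_m -> row_sense)
    (vs : 'I_n -> var_sense) (A : 'M[R]_(m, n)) b c (t : R) :
  dual_feasible_set rs vs A c !=set0 ->
  (forall y, dual_feasible_set rs vs A c y -> (b^T *m y) 0 0 < t) ->
  exists2 x, feasible_set rs vs A b x & (c^T *m x) 0 0 <= t.
Proof.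
move=> feas_y lt_t.
have [y /lt_t yt|x /dual_dual_feasible feas_x tx] :=
    @primal_bound_certified _ _ _ _ _ _ c (- b) (- t) feas_y.
  by rewrite linearN mulNmx mxE ltrN2.
by exists (- x) => //; rewrite mulmxN mxE lerNl.
Qed.

Lemma lte_real_between (R : realFieldType) (u v : \bar R) :
  (u < v)%E -> exists t : R, (u < t%:E)%E /\ (t%:E < v)%E.
Proof.
case: u v => [u| |] [v| |] //.
- by rewrite lte_fin => uv; exists ((u + v) / 2); rewrite !lte_fin; split; lra.
- by move=> _; exists (u + 1); rewrite ltry lte_fin; split=> //; lra.
- by move=> _; exists (v - 1); rewrite ltNyr lte_fin; split=> //; lra.
- by move=> _; exists 0; rewrite ltNyr ltry.
Qed.

Lemma strong_duality (R : realType) (m n : nat) (rs : 'I_m -> row_sense)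
    (vs : 'I_n -> var_sense) (A : 'M[R]_(m, n)) b c :
  feasible_set rs vs A b !=set0 \/ dual_feasible_set rs vs A c !=set0 ->
  primal_value rs vs A b c = dual_value rs vs A b c.
Proof.
move=> feas; apply: le_anti; apply/andP; split; last first.
  apply/ereal_supP => _ [y feas_y <-]; apply/ereal_infP => _ [x feas_x <-].
  by rewrite lee_fin; apply: weak_duality feas_x feas_y.
rewrite leNgt; apply/negP => /lte_real_between[t [dt tp]].
have tx x : feasible_set rs vs A b x -> t < (c^T *m x) 0 0.
  move=> feas_x; rewrite -lte_fin; apply: lt_le_trans tp _.
  by apply: ereal_inf_lbound; exists x.
have yt y : dual_feasible_set rs vs A c y -> (b^T *m y) 0 0 < t.
  move=> feas_y; rewrite -lte_fin; apply: le_lt_trans dt.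
  by apply: ereal_sup_ubound; exists y.
case: feas => [/primal_bound_certified/(_ tx)[y /yt]
              |/dual_bound_certified/(_ yt)[x /tx]]; by rewrite ltNge => /negP.
Qed.

Theorem proposition4 (R : realType) (m n : nat)
    (rs : 'I_m -> row_sense) (vs : 'I_n -> var_sense)
    (IA : interval_mx R m n) (Ib : interval_mx R m 1)
    (Ic : interval_mx R n 1) :
  primal_strongly_feasible rs vs IA Ib Ic \/
  dual_strongly_feasible rs vs IA Ib Ic ->
  gap_strongly_zero rs vs IA Ib Ic.
Proof.
move=> feas A b c scen; rewrite /duality_gap strong_duality ?eqxx //.
by case: feas => feas; [left|right]; apply: feas scen.
Qed.
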